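(* Let $(\theta(t),\varpi(t))$, $t\ge 0$, be a solution of the post-fault dynamics $$\dot\theta_i=\frac{\partial E}{\partial \varpi_i}(\theta,\varpi),\qquad \dot\varpi_i=-\frac{\partial E}{\partial\theta_i}(\theta,\varpi)-\frac{\gamma_i}{M_i}\varpi_i\qquad (i\in\mathcal V),$$ with initial (post-fault) state $(\theta(0),\varpi(0))=(\theta_*,\varpi_* )$, where $\theta_*\in\Theta_{\mathrm{relay}}$, and let $E_*=E(\theta_*,\varpi_* )$. Suppose $E_*\ge E_{\min}$ and that, for every line $\{i,j\}\in\mathcal E$, the optimization problem $$\max_\theta\ |\theta_i-\theta_j|\quad\text{s.t.}\quad U(\theta)\le E_*,\ \ \theta\in\Theta_{\mathrm{relay}}$$ attains its maximum and every optimal solution $\theta$ lies in the interior of $\Theta_{\mathrm{relay}}$, i.e. satisfies $|\theta_k-\theta_h|<\theta^{\max}_{kh}$ for all $\{k,h\}\in\mathcal E$. Then the post-fault dynamics are secure: $\theta(t)\in\Theta_{\mathrm{relay}}$ for all $t\ge 0$, i.e. $|\theta_k(t)-\theta_h(t)|\le\theta^{\max}_{kh}$ for all $\{k,h\}\in\mathcal E$ and all $t\ge0$.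
   Context: $(\mathcal V,\mathcal E)$ is a finite undirected graph (the power network: vertices are buses, edges are lossless lines), with susceptances $\beta_{ij}>0$ for $\{i,j\}\in\mathcal E$, constant voltages $v_i>0$, inertias $M_i>0$, damping coefficients $\gamma_i\ge 0$, and power injections $p_i\in\mathbb R$ for $i\in\mathcal V$ with $\sum_{i\in\mathcal V}p_i=0$. For $\theta,\varpi\in\mathbb R^{\mathcal V}$ (phases and momenta), the potential energy is $$U(\theta)=\sum_{\{i,j\}\in\mathcal E}\beta_{ij}v_iv_j\bigl(1-\cos(\theta_i-\theta_j)\bigr)-\sum_{i\in\mathcal V}p_i\theta_i,$$ and the total energy is $E(\theta,\varpi)=\sum_{i\in\mathcal V}\frac{\varpi_i^2}{2M_i}+U(\theta)$. Relay limits are given numbers $\theta^{\max}_{ij}\in(0,\pi/2]$ for $\{i,j\}\in\mathcal E$, and $\Theta_{\mathrm{relay}}=\{\theta\in\mathbb R^{\mathcal V}: |\theta_i-\theta_j|\le\theta^{\max}_{ij}\ \text{for all } \{i,j\}\in\mathcal E\}$. Also $E_{\min}=\min\{U(\theta): |\theta_i-\theta_j|\le \pi/2\ \text{for all}\ \{i,j\}\in\mathcal E\}$. *)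

(* Defs.v *)
From mathcomp Require Import all_boot all_order all_algebra.
From mathcomp Require Import all_classical all_reals all_analysis.
Import Order.TTheory GRing.Theory Num.Theory.
Import numFieldNormedType.Exports.

Set Implicit Arguments.
Unset Strict Implicit.
Unset Printing Implicit Defensive.

Local Open Scope classical_set_scope.
Local Open Scope ring_scope.

(* Partial derivative of f in the coordinate i at x. *)
Definition partial (R : realType) (V : finType) (f : (V -> R) -> R) (i : V)
    (x : V -> R) : R :=
  derive1 (fun s : R => f [eta x with i |-> s]) (x i).

(* x : [0, +oo[ -> R is differentiable at t >= 0 with derivative l, one-sided
   when t = 0.  The values of x at negative times play no role. *)
Definition has_deriv_nneg (R : realType) (x : R -> R) (t l : R) : Prop :=
  (fun s : R => (x s - x t) / (s - t)) @ within [set s : R | 0 <= s] t^' --> l.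

Section PowerNetwork.
Variables (R : realType) (V : finType).
(* A quantity attached to the lines is a function of two buses, which the
   theorem assumes symmetric; its values off the edges are never used. *)
Variables (edge : rel V) (beta : V -> V -> R) (v p M gamma : V -> R).
Variable theta_max : V -> V -> R.

(* Each line {i, j} occurs as (i, j) and as (j, i) in the double sum, hence the
   factor 1/2. *)
Definition potential (theta : V -> R) : R :=
  2^-1 * (\sum_(i : V) \sum_(j : V | edge i j)
            beta i j * v i * v j * (1 - cos (theta i - theta j)))
  - \sum_(i : V) p i * theta i.

Definition energy (theta varpi : V -> R) : R :=
  \sum_(i : V) varpi i ^+ 2 / (2 * M i) + potential theta.

Definition Theta_relay : set (V -> R) :=
  [set theta | forall i j, edge i j ->
     `|theta i - theta j| <= theta_max i j].

Definition Theta_relay_interior : set (V -> R) :=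
  [set theta | forall i j, edge i j ->
     `|theta i - theta j| < theta_max i j].

Definition Theta_half_pi : set (V -> R) :=
  [set theta | forall i j, edge i j -> `|theta i - theta j| <= pi / 2].

(* The graph need not be connected; when the injections do not sum to 0 on each
   component, the potential is unbounded below on Theta_half_pi and no minimum
   exists.  The extended-real infimum is -oo in that case, and it is the minimum
   as soon as there is one (E_minE). *)
Definition E_min : \bar R :=
  ereal_inf [set (potential theta)%:E | theta in Theta_half_pi].

Lemma E_minE (theta : V -> R) : Theta_half_pi theta ->
  (forall theta', Theta_half_pi theta' -> potential theta <= potential theta') ->
  E_min = (potential theta)%:E.
Proof.
move=> h hmin; apply/eqP; rewrite eq_le; apply/andP; split.
  by apply: ereal_inf_lbound; exists theta.
by apply: le_ereal_inf_tmp => _ [theta' h' <-]; rewrite lee_fin; exact: hmin.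
Qed.

Definition feasible (E_star : R) : set (V -> R) :=
  [set theta | potential theta <= E_star /\ Theta_relay theta].

Definition optimal (E_star : R) (i j : V) : set (V -> R) :=
  [set theta | feasible E_star theta /\
     forall theta', feasible E_star theta' ->
       `|theta' i - theta' j| <= `|theta i - theta j|].

Definition post_fault_solution (theta varpi : R -> V -> R) : Prop :=
  forall (t : R) (i : V), 0 <= t ->
    has_deriv_nneg (fun s => theta s i) t
      (partial (fun w => energy (theta t) w) i (varpi t)) /\
    has_deriv_nneg (fun s => varpi s i) t
      (- partial (fun th => energy th (varpi t)) i (theta t)
       - gamma i / M i * varpi t i).

End PowerNetwork.

(* Main.v *)
(** The energy is nonincreasing along the trajectory, so U(theta(t)) <= E_star for
    all t >= 0.  Hence, whenever theta(t) lies in Theta_relay it is feasible for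
    every one of the optimization problems, and |theta_i(t) - theta_j(t)| is at
    most the optimal value for the line {i, j}, which is < theta_max i j as the
    optimizers are interior.  So the trajectory can never sit on the boundary of
    Theta_relay, and by continuity there is no first exit time. *)
Require Import Defs.
From mathcomp Require Import all_boot all_order all_algebra.
From mathcomp Require Import all_classical all_reals all_analysis.
From mathcomp Require Import ring.
Import Order.TTheory GRing.Theory Num.Theory.

Local Open Scope classical_set_scope.
Local Open Scope ring_scope.

Import numFieldNormedType.Exports.

Set Implicit Arguments.
Unset Strict Implicit.

(** * Finite sums, and derivatives taken on the half-line of nonnegative times *)

Lemma is_derive_bigsum (R : numFieldType) (U W : normedModType R) (I : finType)
    (P : pred I) (f : I -> U -> W) (df : I -> W) (x u : U) :
  (forall i, P i -> is_derive x u (f i) (df i)) ->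
  is_derive x u (fun y => \sum_(i | P i) f i y) (\sum_(i | P i) df i).
Proof.
move=> H.
suff -> : (fun y => \sum_(i | P i) f i y) = \sum_(i | P i) f i.
  by apply: (big_rec2 (fun g dg => is_derive x u g dg)) => [|i g dg Pi Hg];
    [exact: is_derive_cst | apply: is_deriveD => //; exact: H].
by apply/funext => y; rewrite fct_sumE.
Qed.

Lemma cvg_bigsum (R : numFieldType) (W : normedModType R) (T : Type) (I : finType)
    (P : pred I) (F : set_system T) (FF : Filter F) (f : I -> T -> W) (l : I -> W) :
  (forall i, P i -> f i x @[x --> F] --> l i) ->
  \sum_(i | P i) f i x @[x --> F] --> \sum_(i | P i) l i.
Proof. by move=> Hf; apply: (@cvg_big W I +%R 0 P (@add_continuous _)). Qed.

(** Near a time [t > 0] the constraint [0 <= s] holds automatically, so the restricted limit is a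
    limit over the whole punctured neighbourhood; the substitution [s = h + t] then yields the
    quotient in the definition of the derivative. *)
Lemma nneg_deriv_is_derive (R : realType) (x : R -> R) (t l : R) :
  0 < t -> has_deriv_nneg x t l -> is_derive t 1 x l.
Proof.
move=> t0 H.
have H1 : (fun s : R => (x s - x t) / (s - t)) @ t^' --> l.
  apply: cvg_trans H; apply: cvg_app => A /=.
  rewrite /within/= !nbhs_simpl /= => HA.
  have Ht : \forall s \near t^', 0 <= s.
    by apply: nbhs_dnbhs; near=> s; apply: ltW; near: s; exact: lt_nbhsr.
  by apply: filterS2 Ht HA => s s0; apply.
have shift_t : h + t @[h --> 0^'] --> t^'.
  move=> A /= HA; rewrite nbhs_simpl /=.
  have Hc : h + t @[h --> (0 : R)] --> t.
    by rewrite -[X in _ --> X]add0r; apply: cvgD; [exact: cvg_id|exact: cvg_cst].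
  have := Hc _ HA; rewrite nbhs_simpl /= => H0.
  by apply: filterS H0 => h + h0; apply; rewrite -subr_eq0 addrK.
have H2 : h^-1 *: ((x \o shift t) (h *: (1 : R)) - x t) @[h --> 0^'] --> l.
  have := cvg_comp _ _ shift_t H1; apply: cvg_trans; apply: near_eq_cvg.
  by near=> h => /=; rewrite addrK mulrC /GRing.scale /= mulr1.
have D : derivable x t 1 by apply/cvg_ex; exists l.
by apply: DeriveDef => //; apply: cvg_lim.
Unshelve. all: by end_near. Qed.

(** For [s != t], [x s] is the difference quotient times [s - t], plus [x t], and the first product
    tends to [l * 0]. This covers [t = 0], where no two-sided derivative is at hand. *)
Lemma nneg_deriv_right_cvg (R : realType) (x : R -> R) (t l : R) :
  0 <= t -> has_deriv_nneg x t l -> x s @[s --> t^'+] --> x t.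
Proof.
move=> t0 H.
have H1 : (x s - x t) / (s - t) @[s --> t^'+] --> l.
  apply: cvg_trans H; apply: cvg_app => A /=.
  move=> HA; have {}HA : \forall s \near t, s != t -> 0 <= s -> A s by exact: HA.
  change (\forall s \near t, t < s -> A s).
  apply: filterS HA => s + ts.
  by apply; [rewrite gt_eqF|rewrite (le_trans t0)// ltW].
have H2 : (s - t) @[s --> t^'+] --> t - t.
  by apply: cvgB; [apply: cvg_at_right_filter; exact: cvg_id|exact: cvg_cst].
have H3 : (x s - x t) / (s - t) * (s - t) + x t @[s --> t^'+] --> x t.
  suff : (x s - x t) / (s - t) * (s - t) + x t @[s --> t^'+] -->
      l * (t - t) + x t by rewrite subrr mulr0 add0r.
  by apply: cvgD; [exact: cvgM|exact: cvg_cst].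
apply: cvg_trans H3; apply: near_eq_cvg; near=> s => /=.
by rewrite divfK ?subrK// subr_eq0 gt_eqF.
Unshelve. all: by end_near. Qed.

(** * Differentiation of the energy along a path, and its dissipation *)

Section EnergyAlongPaths.
Context (R : realType) (V : finType) (edge : rel V).
Context (beta : V -> V -> R) (v p M gamma : V -> R).

(** The differential of [potential] at [th], applied to the direction [dth]. The explicit formula
    makes linearity in [dth] a matter of algebra. *)
Definition dpotential (th dth : V -> R) : R :=
  2^-1 * (\sum_i \sum_(j | edge i j)
            beta i j * v i * v j * (sin (th i - th j) * (dth i - dth j)))
  - \sum_i p i * dth i.

Lemma is_derive_potential (x : R -> V -> R) (dx : V -> R) (t : R) :
  (forall a, is_derive t 1 (fun s => x s a) (dx a)) ->
  is_derive t 1 (fun s => potential edge beta v p (x s)) (dpotential (x t) dx).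
Proof.
move=> dxE; apply: is_deriveB; last first.
  by apply: is_derive_bigsum => i _; exact: is_deriveZ.
apply: is_deriveZ; apply: is_derive_bigsum => i _.
apply: is_derive_bigsum => j _; apply: is_deriveZ.
have Hc : is_derive t 1 (cos \o (fun s => x s i - x s j))
    (- sin (x t i - x t j) * (dx i - dx j)).
  by apply: is_derive1_comp; exact: is_deriveB.
have := is_deriveB (is_derive_cst (1:R) t 1) Hc.
by rewrite mulNr opprK add0r.
Qed.

Lemma is_derive_energy (x w : R -> V -> R) (dx dw : V -> R) (t : R) :
  (forall i, M i != 0) ->
  (forall a, is_derive t 1 (fun s => x s a) (dx a)) ->
  (forall a, is_derive t 1 (fun s => w s a) (dw a)) ->
  is_derive t 1 (fun s => energy edge beta v p M (x s) (w s))
    (\sum_i w t i / M i * dw i + dpotential (x t) dx).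
Proof.
move=> M0 dxE dwE; apply: is_deriveD; last exact: is_derive_potential.
apply: is_derive_bigsum => i _.
(* As a scaled power of a function, the kinetic term has a derivative that instance inference can
   build. *)
have -> : (fun s => w s i ^+ 2 / (2 * M i)) =
          (2 * M i)^-1 \*: ((fun s => w s i) ^+ 2).
  by apply/funext => s; rewrite /= mulrC.
apply: is_derive_eq.
rewrite /GRing.scale /= expr1; field; exact: M0.
Qed.

Lemma dpotential0 (th : V -> R) : dpotential th (fun=> 0) = 0.
Proof.
rewrite /dpotential big1 => [|i _]; last first.
  by rewrite big1 // => j _; rewrite subrr !mulr0.
by rewrite big1 ?mulr0 ?subrr // => i _; rewrite mulr0.
Qed.

Lemma dpotentialD (th a b : V -> R) :
  dpotential th (fun k => a k + b k) = dpotential th a + dpotential th b.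
Proof.
rewrite /dpotential addrACA -opprD -mulrDr -!big_split /=.
congr (_ - _); last by apply: eq_bigr => i _; exact: mulrDr.
congr (2^-1 * _); apply: eq_bigr => i _.
by rewrite -big_split /=; apply: eq_bigr => j _; ring.
Qed.

Lemma dpotentialZ (th a : V -> R) c :
  dpotential th (fun k => c * a k) = c * dpotential th a.
Proof.
rewrite /dpotential mulrBr mulrCA !mulr_sumr.
congr (_ - _); last by apply: eq_bigr => i _; ring.
apply: eq_bigr => i _; congr (2^-1 * _).
by rewrite mulr_sumr; apply: eq_bigr => j _; ring.
Qed.

(** Linearity, with [dth] expanded in the standard basis. The coefficients are the partial
    derivatives of the potential, so this links the chain rule along a path to the right-hand sides
    of the dynamics. *)
Lemma dpotential_basis (th dth : V -> R) :
  dpotential th dth = \sum_i dth i * dpotential th (fun k => (k == i)%:R).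
Proof.
(* Additivity is available for two directions only, so the sum is handled by induction on an
   arbitrary list of buses. *)
have sumE (r : seq V) : \sum_(i <- r) dth i * dpotential th (fun k => (k == i)%:R) =
    dpotential th (fun k => \sum_(i <- r) dth i * (k == i)%:R).
  elim: r => [|a r IH].
    rewrite big_nil -[LHS](dpotential0 th); congr dpotential.
    by apply/funext => k; rewrite big_nil.
  rewrite big_cons IH -dpotentialZ -dpotentialD; congr dpotential.
  by apply/funext => k; rewrite big_cons.
rewrite sumE; congr dpotential; apply/funext => k.
rewrite (bigD1 k) //= eqxx mulr1 big1 ?addr0 // => i ik.
by rewrite eq_sym (negbTE ik) mulr0.
Qed.

Lemma is_derive_update (x : V -> R) (i a : V) (t : R) :
  is_derive t 1 (fun s : R => [eta x with i |-> s] a) (a == i)%:R.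
Proof.
by rewrite /=; case: eqP => _; [exact: is_derive_id|exact: is_derive_cst].
Qed.

Lemma update_id (x : V -> R) (i : V) : [eta x with i |-> x i] = x :> (V -> R).
Proof. by apply/funext => a /=; case: eqP => // ->. Qed.

(** A partial derivative is a derivative along the path that moves one coordinate at unit speed, so
    [is_derive_energy] applies, with all momenta constant. *)
Lemma partial_energy_phase (th w : V -> R) (i : V) : (forall i, M i != 0) ->
  partial (fun y => energy edge beta v p M y w) i th =
  dpotential th (fun k => (k == i)%:R).
Proof.
move=> M0; rewrite /partial derive1E.
have := is_derive_energy M0 (fun a => is_derive_update th i a (th i))
  (fun a => is_derive_cst (w a) (th i) 1).
move=> /@derive_val ->; rewrite update_id big1 ?add0r // => k _.
by rewrite mulr0.
Qed.

Lemma partial_energy_momentum (th w : V -> R) (i : V) : (forall i, M i != 0) ->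
  partial (fun y => energy edge beta v p M th y) i w = w i / M i.
Proof.
move=> M0; rewrite /partial derive1E.
have := is_derive_energy M0 (fun a => is_derive_cst (th a) (w i) 1)
  (fun a => is_derive_update w i a (w i)).
move=> /@derive_val ->; rewrite update_id dpotential0 addr0.
rewrite (bigD1 i) //= eqxx mulr1 big1 ?addr0 // => k ki.
by rewrite (negbTE ki) mulr0.
Qed.

(** The filter is arbitrary so that the lemma applies to right-hand limits at time 0. *)
Lemma cvg_energy (T : Type) (F : set_system T) (FF : Filter F)
    (x w : T -> V -> R) (x0 w0 : V -> R) :
  (forall a, x s a @[s --> F] --> x0 a) ->
  (forall a, w s a @[s --> F] --> w0 a) ->
  energy edge beta v p M (x s) (w s) @[s --> F] --> energy edge beta v p M x0 w0.
Proof.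
move=> xx0 ww0; apply: cvgD.
  apply: cvg_bigsum => i _; apply: cvgM; last exact: cvg_cst.
  by under eq_cvg do rewrite expr2; rewrite expr2; exact: cvgM.
apply: cvgB; last by apply: cvg_bigsum => i _; apply: cvgM => //; exact: cvg_cst.
apply: cvgM; first exact: cvg_cst.
apply: cvg_bigsum => i _; apply: cvg_bigsum => j _; apply: cvgM; first exact: cvg_cst.
apply: cvgB; first exact: cvg_cst.
by apply: continuous_cvg; [exact: continuous_cos|exact: cvgB].
Qed.

Lemma potential_le_energy (th w : V -> R) : (forall i, 0 < M i) ->
  potential edge beta v p th <= energy edge beta v p M th w.
Proof.
move=> M0; rewrite lerDr; apply: sumr_ge0 => i _.
by rewrite divr_ge0 ?sqr_ge0 // mulr_ge0 // ltW.
Qed.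

Lemma energy_nincr (theta varpi : R -> V -> R) :
  (forall i, 0 < M i) -> (forall i, 0 <= gamma i) ->
  post_fault_solution edge beta v p M gamma theta varpi ->
  forall t : R, 0 <= t -> energy edge beta v p M (theta t) (varpi t) <=
                      energy edge beta v p M (theta 0) (varpi 0).
Proof.
move=> M_gt0 gamma_ge0 dyn t t0.
have M0 i : M i != 0 by rewrite gt_eqF.
pose f (s : R) := energy edge beta v p M (theta s) (varpi s).
have df (s : R) : 0 < s -> is_derive s 1 f (- \sum_i gamma i * (varpi s i / M i) ^+ 2).
  move=> s0.
  have dth a := nneg_deriv_is_derive s0 (dyn s a (ltW s0)).1.
  have dw a := nneg_deriv_is_derive s0 (dyn s a (ltW s0)).2.
  apply: is_derive_eq (is_derive_energy M0 dth dw) _.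
  rewrite dpotential_basis -big_split /= -sumrN; apply: eq_bigr => i _.
  by rewrite partial_energy_phase // partial_energy_momentum //; field.
apply: (@ler0_derive1_nincry R f 0) => // [s|s|].
- by rewrite in_itv /= andbT => /df[].
- rewrite in_itv /= andbT derive1E => /df/@derive_val->.
  by rewrite oppr_le0 sumr_ge0 // => i _; rewrite mulr_ge0 // sqr_ge0.
apply/continuous_within_itvcyP; split.
  move=> s; rewrite in_itv /= andbT => /df[+ _].
  by move=> /derivable1_diffP/differentiable_continuous.
by apply: cvg_energy => a;
  [exact: nneg_deriv_right_cvg (dyn 0 a (lexx _)).1
  |exact: nneg_deriv_right_cvg (dyn 0 a (lexx _)).2].
Qed.

End EnergyAlongPaths.

Unset Implicit Arguments.
Set Strict Implicit.

Theorem mainTheorem1 (R : realType) (V : finType) (edge : rel V)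
    (edge_sym : symmetric edge) (edge_irrefl : irreflexive edge)
    (beta : V -> V -> R) (v M gamma p : V -> R) (theta_max : V -> V -> R)
    (beta_sym : forall i j, edge i j -> beta i j = beta j i)
    (beta_gt0 : forall i j, edge i j -> 0 < beta i j)
    (v_gt0 : forall i, 0 < v i)
    (M_gt0 : forall i, 0 < M i)
    (gamma_ge0 : forall i, 0 <= gamma i)
    (p_sum0 : \sum_(i : V) p i = 0)
    (theta_max_sym : forall i j, edge i j -> theta_max i j = theta_max j i)
    (theta_max_bounds : forall i j, edge i j -> 0 < theta_max i j <= pi / 2)
    (theta varpi : R -> V -> R) (theta_star varpi_star : V -> R) (E_star : R)
    (dynamics : post_fault_solution edge beta v p M gamma theta varpi)
    (theta0 : theta 0 = theta_star) (varpi0 : varpi 0 = varpi_star)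
    (theta_star_relay : Theta_relay edge theta_max theta_star)
    (E_starE : E_star = energy edge beta v p M theta_star varpi_star)
    (E_star_ge : (E_min edge beta v p <= E_star%:E)%E)
    (optima_interior : forall i j, edge i j ->
       (exists th, optimal edge beta v p theta_max E_star i j th) /\
       (forall th, optimal edge beta v p theta_max E_star i j th ->
          Theta_relay_interior edge theta_max th)) :
  forall t : R, 0 <= t -> Theta_relay edge theta_max (theta t).
Proof.
have M0 i : M i != 0 by rewrite gt_eqF.
have right_cvg i (t : R) : 0 <= t -> theta s i @[s --> t^'+] --> theta t i.
  by move=> t0; exact: nneg_deriv_right_cvg (dynamics t i t0).1.
have cts i (t : R) : 0 < t -> theta s i @[s --> t] --> theta t i.
  move=> t0; have [+ _] := nneg_deriv_is_derive t0 (dynamics t i (ltW t0)).1.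
  by move=> /derivable1_diffP/differentiable_continuous.
have relay_interior (t : R) : 0 <= t -> Theta_relay edge theta_max (theta t) ->
    Theta_relay_interior edge theta_max (theta t).
  move=> t0 relay_t i j eij.
  have [[th opt_th] opt_int] := optima_interior i j eij.
  apply: le_lt_trans (opt_int _ opt_th i j eij); apply: opt_th.2; split => //.
  apply: le_trans (potential_le_energy _ _ _ _ _ (varpi t) M_gt0) _.
  by rewrite E_starE -theta0 -varpi0; exact: (energy_nincr M_gt0 gamma_ge0 dynamics).
move=> t1 t1_ge0; apply: contrapT => bad_t1.
pose bad := [set s : R | 0 <= s /\ ~ Theta_relay edge theta_max (theta s)].
have bad0 : has_inf bad by split; [exists t1|exists 0 => s []].
pose T := inf bad.
have T0 : 0 <= T by apply: lb_le_inf; [exists t1|move=> s []].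
have before (s : R) : 0 <= s -> s < T -> Theta_relay edge theta_max (theta s).
  move=> s0; apply: contraPP => bad_s; apply/negP; rewrite -leNgt.
  by apply: ge_inf; [exact: bad0.2|].
have relay_T : Theta_relay edge theta_max (theta T).
  move: T0; rewrite le_eqVlt => /orP[/eqP <-|T_gt0]; first by rewrite theta0.
  move=> i j eij; rewrite leNgt; apply/negP => gtT.
  have cvgT : `|theta s i - theta s j| @[s --> T^'-] --> `|theta T i - theta T j|.
    by apply: cvg_norm; apply: cvgB; apply: cvg_at_left_filter; exact: cts.
  have : \forall s \near T^'-, False.
    near=> s.
    have : theta_max i j < `|theta s i - theta s j|.
      by near: s; exact: (cvgr_gt _ cvgT).
    apply/negP; rewrite -leNgt; apply: before => //.
    by apply: ltW; near: s; exact: nbhs_left_gt.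
  by move=> /filter_ex[].
have : \forall s \near T^'+, Theta_relay edge theta_max (theta s).
  have : \forall s \near T^'+, forall ij : V * V, edge ij.1 ij.2 ->
      `|theta s ij.1 - theta s ij.2| <= theta_max ij.1 ij.2.
    apply: filter_forall => -[i j] /=.
    have [eij|_] := boolP (edge i j); last exact: nearW.
    have cvgT : `|theta s i - theta s j| @[s --> T^'+] --> `|theta T i - theta T j|.
      by apply: cvg_norm; apply: cvgB; exact: right_cvg.
    apply: filterS (cvgr_lt _ cvgT _ (relay_interior T T0 relay_T i j eij)).
    by move=> s /ltW.
  by move=> near_ij; apply: filterS near_ij => s Hs i j; exact: (Hs (i, j)).
move=> [e /= e0 He].
have [s [s0 bad_s] sTe] := inf_adherent e0 bad0.
have Ts : T <= s by apply: ge_inf; [exact: bad0.2|].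
apply: bad_s; move: Ts; rewrite le_eqVlt => /orP[/eqP <- //|Ts].
by apply: He => //=; rewrite distrC gtr0_norm ?subr_gt0 // ltrBlDl.
Unshelve. all: by end_near. Qed.
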